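(* Let $X$ be an order continuous Banach lattice, and let $B_X$ be its closed unit ball. Then $B_X$ is un-complete if and only if $X$ is a KB-space.
   Context: Let $X$ be a Banach lattice with positive cone $X_+$. ''Order continuous Banach lattice'' means a Banach lattice with order continuous norm. A net $(x_\alpha)$ in $X$ un-converges to $x\in X$ if $\bigl\lVert |x_\alpha-x|\wedge u\bigr\rVert\to 0$ for every $u\in X_+$. The un-topology on $X$ is the linear topology whose base of zero neighborhoods is given by the sets $V_{\varepsilon,u}=\{x\in X : \lVert |x|\wedge u\rVert<\varepsilon\}$, where $\varepsilon>0$ and $0\ne u\in X_+$; convergence of nets in this topology is exactly un-convergence. A net $(x_\alpha)$ is un-Cauchy if for every un-neighborhood $U$ of zero there exists $\alpha_0$ such that $x_\alpha-x_\beta\in U$ whenever $\alpha,\beta\ge\alpha_0$. A subset $C$ of $X$ is un-complete if every un-Cauchy net in $C$ un-converges to an element of $C$. A Banach lattice is a KB-space if every norm bounded increasing sequence of positive vectors is norm convergent. *)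

(* Defs.v *)
From HB Require Import structures.
From mathcomp Require Import all_boot all_order all_algebra.
From mathcomp Require Import all_classical all_reals all_analysis.

Set Implicit Arguments.
Unset Strict Implicit.
Unset Printing Implicit Defensive.

Import Order.TTheory GRing.Theory Num.Theory.
Import numFieldNormedType.Exports.

Local Open Scope classical_set_scope.
Local Open Scope ring_scope.

(* The mixin carries its own order and lattice operations because inheriting from
   both a normed module and Order.Lattice is rejected by HB (missing joins with
   the Num hierarchy); the library's lattice structure is recovered just below. *)
HB.mixin Record CompleteNormedModule_isBanachLattice (R : realType) X
    of CompleteNormedModule R X := {
  bl_le : rel X ;
  bl_meet : X -> X -> X ;
  bl_join : X -> X -> X ;
  bl_le_refl : reflexive bl_le ;
  bl_le_anti : antisymmetric bl_le ;
  bl_le_trans : transitive bl_le ;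
  bl_lexI : forall x y z : X, bl_le x (bl_meet y z) = bl_le x y && bl_le x z ;
  bl_leUx : forall x y z : X, bl_le (bl_join x y) z = bl_le x z && bl_le y z ;
  bl_leD2r : forall x y z : X, bl_le x y -> bl_le (x + z) (y + z) ;
  bl_scale_ge0 : forall (a : R) (x : X), 0 <= a -> bl_le 0 x -> bl_le 0 (a *: x) ;
  bl_le_norm : forall x y : X,
    bl_le (bl_join x (- x)) (bl_join y (- y)) -> `|x| <= `|y|
}.

#[short(type="banachLatticeType")]
HB.structure Definition BanachLattice (R : realType) :=
  {X of CompleteNormedModule R X & CompleteNormedModule_isBanachLattice R X}.

Section BanachLatticeOrder.
Context (R : realType) (X : banachLatticeType R).

HB.instance Definition _ := Order.Le_isPOrder.Build ring_display
  (BanachLattice.sort X) (@bl_le_refl R X) (@bl_le_anti R X) (@bl_le_trans R X).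

Let lexI (x y z : X) : (x <= bl_meet y z) = (x <= y) && (x <= z).
Proof. exact: bl_lexI. Qed.

Let leUx (x y z : X) : (bl_join x y <= z) = (x <= z) && (y <= z).
Proof. exact: bl_leUx. Qed.

HB.instance Definition _ := Order.POrder_MeetJoin_isLattice.Build ring_display
  (BanachLattice.sort X) lexI leUx.

End BanachLatticeOrder.

(* The lattice modulus |x| = x \/ (-x) is an element of X; the notation `|x|
   always denotes the norm of x. *)
Definition modulus (R : realType) (X : banachLatticeType R) (x : X) : X :=
  (x `|` - x)%O.

(* Directed preorders; antisymmetry is not required. *)
Definition directed (A : Type) (le : A -> A -> Prop) : Prop :=
  [/\ inhabited A,
      forall a, le a a,
      forall a b c, le a b -> le b c -> le a c &
      forall a b, exists c, le a c /\ le b c].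

Definition tails (A : Type) (le : A -> A -> Prop) : set_system A :=
  filter_from setT (fun a0 => [set a | le a0 a]).

Section BanachLatticeDefs.
Context {R : realType} (X : banachLatticeType R).

Definition order_continuous_norm : Prop :=
  forall (A : Type) (le : A -> A -> Prop) (x : A -> X), directed le ->
    (forall a b, le a b -> x b <= x a) ->
    (forall a, 0 <= x a) ->
    (forall z : X, (forall a, z <= x a) -> z <= 0) ->
    `|x a| @[a --> tails le] --> (0 : R).

Definition KB_space : Prop :=
  forall x : nat -> X,
    (forall n, 0 <= x n) ->
    (forall m n, (m <= n)%N -> x m <= x n) ->
    (exists M : R, forall n, `|x n| <= M) ->
    cvg (x @ \oo).

Definition un_cvg (A : Type) (le : A -> A -> Prop) (x : A -> X) (l : X) : Prop :=
  forall u : X, 0 <= u ->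
    `|(modulus (x a - l) `&` u)%O| @[a --> tails le] --> (0 : R).

Definition un_ball (eps : R) (u : X) : set X :=
  [set x | `|(modulus x `&` u)%O| < eps].

(* The sets un_ball eps u are directed downwards, so no finite intersections
   are needed. When X = 0 there is no admissible u, which is harmless: every
   net is then both un-Cauchy and un-convergent. *)
Definition un_nbhs0 : set_system X :=
  [set U | exists (eps : R) (u : X),
     [/\ 0 < eps, 0 <= u, u != 0 & un_ball eps u `<=` U]].

Definition un_cauchy (A : Type) (le : A -> A -> Prop) (x : A -> X) : Prop :=
  forall U : set X, un_nbhs0 U ->
    exists a0, forall a b, le a0 a -> le a0 b -> U (x a - x b).

Definition un_complete (C : set X) : Prop :=
  forall (A : Type) (le : A -> A -> Prop) (x : A -> X), directed le ->
    (forall a, C (x a)) -> un_cauchy le x ->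
    exists2 l, C l & un_cvg le x l.

Definition closed_unit_ball : set X := [set x | `|x| <= 1].

End BanachLatticeDefs.

Arguments closed_unit_ball {R} X.
Arguments KB_space {R} X.
Arguments order_continuous_norm {R} X.

(* Main.v *)
(* If X is a KB-space and (x_a) is a positive un-Cauchy net in the unit ball,
   then for each u >= 0 the net x_a /\ u is norm Cauchy.  Its limits T u
   increase with u and stay in the ball, so they converge to some x, and
   x_a /\ u -> x /\ u for all u; this forces un-convergence to x.
   Conversely, a norm bounded increasing sequence x_n is un-Cauchy because
     (x_m - x_n) /\ u <= x_m /\ J u - x_n /\ J u + (x_m /\ J u) / J,
   where the order bounded sequence x_n /\ J u is norm Cauchy by order
   continuity and the last term has norm O(1/J).  The un-limit of an increasing
   sequence is an upper bound, and testing against u := the limit itself turns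
   un-convergence into norm convergence. *)
Require Import Defs.
From mathcomp Require Import all_boot all_order all_algebra.
From mathcomp Require Import all_classical all_reals all_analysis.
From mathcomp Require Import lra.

Set Implicit Arguments.
Unset Strict Implicit.
Unset Printing Implicit Defensive.

Import Order.TTheory GRing.Theory Num.Theory.
Import numFieldNormedType.Exports.

Local Open Scope classical_set_scope.
Local Open Scope ring_scope.

(** * Vector lattice inequalities and the lattice norm *)

Section VectorLattice.
Context {R : realType} {X : banachLatticeType R}.
Implicit Types (x y z u v w : X) (a : R).

Definition pospart x : X := (x `|` 0)%O.

Lemma bl_leD2rE z x y : (x + z <= y + z) = (x <= y).
Proof.
apply/idP/idP => h; last exact: bl_leD2r.
by have := @bl_leD2r _ _ _ _ (- z) h; rewrite !addrK.
Qed.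

Lemma bl_leD2lE z x y : (z + x <= z + y) = (x <= y).
Proof. by rewrite ![z + _]addrC bl_leD2rE. Qed.

Lemma bl_leD x y z w : x <= y -> z <= w -> x + z <= y + w.
Proof.
by move=> xy zw; apply: (@le_trans _ _ (y + z)); rewrite ?bl_leD2rE ?bl_leD2lE.
Qed.

Lemma bl_leBlDr x y z : (x - y <= z) = (x <= z + y).
Proof. by rewrite -(bl_leD2rE y (x - y)) subrK. Qed.

Lemma bl_leBrDr x y z : (x <= y - z) = (x + z <= y).
Proof. by rewrite -(bl_leD2rE z x) subrK. Qed.

Lemma bl_subr_ge0 x y : (0 <= y - x) = (x <= y).
Proof. by rewrite bl_leBrDr add0r. Qed.

Lemma bl_leN2 x y : (- x <= - y) = (y <= x).
Proof. by rewrite -(bl_subr_ge0 (- x)) opprK addrC bl_subr_ge0. Qed.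

Lemma bl_scaler_ge0 a x : 0 <= a -> 0 <= x -> 0 <= a *: x.
Proof. exact: bl_scale_ge0. Qed.

Lemma bl_leZ a x y : 0 <= a -> x <= y -> a *: x <= a *: y.
Proof.
move=> a0; rewrite -bl_subr_ge0 => xy; rewrite -bl_subr_ge0 -scalerBr.
exact: bl_scaler_ge0.
Qed.

Lemma bl_addr_ge0 x y : 0 <= x -> 0 <= y -> 0 <= x + y.
Proof. by move=> x0 y0; rewrite -[0]addr0; exact: bl_leD. Qed.

Lemma meetDr x y z : (x `&` y)%O + z = ((x + z) `&` (y + z))%O.
Proof.
apply/le_anti/andP; split.
  by rewrite lexI !bl_leD2rE leIl leIr.
by rewrite -bl_leBlDr lexI !bl_leBlDr leIl leIr.
Qed.

Lemma pospart_ge0 x : 0 <= pospart x.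
Proof. exact: leUr. Qed.

Lemma pospart_ge x : x <= pospart x.
Proof. exact: leUl. Qed.

Lemma pospartB x : pospart x - pospart (- x) = x.
Proof.
apply/eqP; rewrite subr_eq; apply/eqP/le_anti/andP; split.
  rewrite leUx; apply/andP; split.
    by rewrite -[leLHS]addr0 bl_leD2lE pospart_ge0.
  by rewrite addrC -bl_leBlDr sub0r pospart_ge.
rewrite addrC -bl_leBrDr leUx; apply/andP; split.
  by rewrite -[leLHS]add0r bl_leD2rE pospart_ge0.
by rewrite bl_subr_ge0 pospart_ge.
Qed.

Lemma pospart_subr x y : pospart (x - y) = x - (x `&` y)%O.
Proof.
apply/le_anti/andP; split.
  by rewrite leUx bl_subr_ge0 leIl andbT bl_leD2lE bl_leN2 leIr.
rewrite bl_leBlDr addrC -bl_leBlDr lexI; apply/andP; split.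
  by rewrite bl_leBlDr -[leLHS]addr0 bl_leD2lE pospart_ge0.
by rewrite bl_leBlDr addrC -bl_leBlDr pospart_ge.
Qed.

Lemma modulus_ge x : x <= modulus x.
Proof. exact: leUl. Qed.

Lemma modulus_geN x : - x <= modulus x.
Proof. exact: leUr. Qed.

Lemma modulus_le x y : x <= y -> - x <= y -> modulus x <= y.
Proof. by move=> *; rewrite leUx; apply/andP. Qed.

Lemma modulusN x : modulus (- x) = modulus x.
Proof. by rewrite /modulus opprK joinC. Qed.

Lemma modulus_distC x y : modulus (x - y) = modulus (y - x).
Proof. by rewrite -modulusN opprB. Qed.

(** Adding [x <= modulus x] and [- x <= modulus x] gives twice the modulus above 0; then halve. *)
Lemma modulus_ge0 x : 0 <= modulus x.
Proof.
have h : 0 <= modulus x + modulus x.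
  by rewrite -[leLHS](subrr x) bl_leD ?modulus_ge ?modulus_geN.
have -> : modulus x = 2^-1 *: (modulus x + modulus x).
  by rewrite scalerDr -scalerDl -[2^-1]div1r -splitr scale1r.
by apply: bl_scaler_ge0 h; rewrite invr_ge0.
Qed.

Lemma ge0_modulus x : 0 <= x -> modulus x = x.
Proof.
move=> x0; apply/le_anti/andP; split; last exact: modulus_ge.
by apply: modulus_le => //; apply: (le_trans _ x0); rewrite -oppr0 bl_leN2.
Qed.

Lemma modulusD x y : modulus (x + y) <= modulus x + modulus y.
Proof.
by apply: modulus_le; rewrite ?opprD bl_leD ?modulus_ge ?modulus_geN.
Qed.

Lemma pospart_le_modulus x y : x <= y -> pospart x <= modulus y.
Proof. by move=> xy; rewrite leUx modulus_ge0 (le_trans xy) ?modulus_ge. Qed.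

Lemma modulus_le_pospart x : modulus x <= pospart x + pospart (- x).
Proof.
apply: modulus_le.
  by rewrite -[leLHS]addr0 bl_leD ?pospart_ge ?pospart_ge0.
by rewrite -[leLHS]add0r bl_leD ?pospart_ge ?pospart_ge0.
Qed.

(** Birkhoff's inequality, making truncation at [u] norm nonexpansive: [x] lies below [y + |x - y|]
    and [u] below [u + |x - y|], so the meet of the left sides lies below the meet of the right
    sides. *)
Lemma modulus_meetB x y u : modulus ((x `&` u)%O - (y `&` u)%O) <= modulus (x - y).
Proof.
have h (p q : X) : (p `&` u)%O - (q `&` u)%O <= modulus (p - q).
  rewrite bl_leBlDr addrC meetDr lexI; apply/andP; split.
    by apply: le_trans (leIl _ _) _; rewrite addrC -bl_leBlDr modulus_ge.
  by apply: le_trans (leIr _ _) _; rewrite -[leLHS]addr0 bl_leD2lE modulus_ge0.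
by apply: modulus_le; rewrite ?opprB // modulus_distC.
Qed.

Lemma modulus_meetB_le x y u : 0 <= x -> 0 <= y -> 0 <= u ->
  modulus ((x `&` u)%O - (y `&` u)%O) <= u.
Proof.
move=> x0 y0 u0.
have h (p q : X) : 0 <= q -> (p `&` u)%O - (q `&` u)%O <= u.
  move=> q0; rewrite bl_leBlDr; apply: le_trans (leIr _ _) _.
  by rewrite -[leLHS]addr0 bl_leD2lE lexI q0.
by apply: modulus_le; rewrite ?opprB h.
Qed.

Lemma modulus_pospartB x y : modulus (pospart x - pospart y) <= modulus (x - y).
Proof.
have h (p q : X) : pospart p - pospart q <= modulus (p - q).
  rewrite bl_leBlDr leUx; apply/andP; split.
    by rewrite -[leLHS](subrK q) bl_leD ?modulus_ge ?pospart_ge.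
  by rewrite bl_addr_ge0 ?modulus_ge0 ?pospart_ge0.
by apply: modulus_le; rewrite ?opprB // modulus_distC.
Qed.

(** With [z] the left-hand side, [z - x] lies below both [y] and [u]; hence [z] minus the meet of
    [y] and [u] lies below both [x] and [u]. *)
Lemma meetD_le x y u : 0 <= x -> 0 <= y -> 0 <= u ->
  ((x + y) `&` u <= (x `&` u)%O + (y `&` u)%O)%O.
Proof.
move=> x0 y0 u0; set z := ((x + y) `&` u)%O.
have zx : z - x <= (y `&` u)%O.
  rewrite lexI !bl_leBlDr [y + x]addrC leIl /=.
  by apply: le_trans (leIr _ _) _; rewrite -[leLHS]addr0 bl_leD2lE.
rewrite -bl_leBlDr lexI; apply/andP; split.
  by rewrite bl_leBlDr addrC -bl_leBlDr.
rewrite bl_leBlDr; apply: le_trans (leIr _ _) _.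
by rewrite -[leLHS]addr0 bl_leD2lE lexI y0.
Qed.

(** The right-hand side involves [y] only through its truncations at [u + x] and at [x], so
    convergence of truncations will give un-convergence. Split [|y - x|] into the positive parts of
    [y - x] and [x - y]. With [m] the meet of [y] and [x], these are [y - m] and [x - m]; replacing
    [m] by [x] in the first costs a second copy of [x - m]. *)
Lemma modulus_meet_le x y u : 0 <= x -> 0 <= u ->
  (modulus (y - x) `&` u <=
    ((y `&` (u + x))%O - x) + (x - (y `&` x)%O) + (x - (y `&` x)%O))%O.
Proof.
move=> x0 u0.
apply: le_trans (leI2 (modulus_le_pospart _) (lexx u)) _.
apply: le_trans (meetD_le (pospart_ge0 _) (pospart_ge0 _) u0) _.
apply: bl_leD; last by rewrite opprB pospart_subr [(y `&` x)%O]meetC leIl.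
rewrite pospart_subr; set m := (y `&` x)%O.
have -> : ((y - m) `&` u)%O = (y `&` (u + m))%O - m by rewrite meetDr addrK.
by rewrite addrA subrK bl_leD2rE leI2// bl_leD2lE leIr.
Qed.

Lemma le_norm_modulus x y : modulus x <= modulus y -> `|x| <= `|y|.
Proof. exact: bl_le_norm. Qed.

Lemma bl_le_norm_ge0 x y : 0 <= x -> x <= y -> `|x| <= `|y|.
Proof.
by move=> x0 xy; apply: le_norm_modulus; rewrite !ge0_modulus// (le_trans x0).
Qed.

Lemma norm_modulus x : `|modulus x| = `|x|.
Proof.
apply/le_anti/andP; split; apply: le_norm_modulus;
  by rewrite (ge0_modulus (modulus_ge0 x)).
Qed.

Lemma norm_pospart_le x y : x <= y -> `|pospart x| <= `|y|.
Proof.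
move=> xy; rewrite -(norm_modulus y).
exact: bl_le_norm_ge0 (pospart_ge0 _) (pospart_le_modulus xy).
Qed.

(** The way back from norm estimates to order: a positive part of arbitrarily small norm
    vanishes. *)
Lemma le0_norm_pospart x : (forall e : R, 0 < e -> `|pospart x| <= e) -> x <= 0.
Proof.
move=> h; suff -> : 0 = pospart x by exact: pospart_ge.
apply/esym/eqP; rewrite -normr_le0; apply/ler_addgt0Pr => e e0.
by rewrite add0r h.
Qed.

(** Dividing by [k] gives [x <= y / k], so the positive part of [x] has norm at most [|y| / k]. *)
Lemma bl_archimedean x y : (forall k : nat, x *+ k <= y) -> x <= 0.
Proof.
move=> h; apply: le0_norm_pospart => e e0.
pose k := (Num.truncn (`|y| / e)).+1.
have k0 : 0 < k%:R :> R by rewrite ltr0n.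
have xy : x <= k%:R^-1 *: y.
  have -> : x = k%:R^-1 *: (x *+ k).
    by rewrite -(scaler_nat k x) scalerA mulVf ?scale1r ?gt_eqF.
  by apply: bl_leZ (h k); rewrite invr_ge0 ler0n.
apply: le_trans (norm_pospart_le xy) _.
rewrite normrZ gtr0_norm ?invr_gt0// mulrC ler_pdivrMr// mulrC -ler_pdivrMr//.
by rewrite ltW// truncnS_gt.
Qed.

(* With [q := y /\ J u] and [c := J / (J + 1)], any [z <= y] such that
   [z <= (J + 1) u] satisfies [c z <= q], that is, [z <= q + q / J]. *)
Lemma meet_incr_le x y u (J : nat) : (0 < J)%N -> 0 <= y -> 0 <= u ->
  (((y - x) `&` u) <= (y `&` (u *+ J)) - (x `&` (u *+ J))
     + J%:R^-1 *: (y `&` (u *+ J)))%O.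
Proof.
move=> J0 y0 u0; set q := (y `&` (u *+ J))%O.
have J1 : J%:R != 0 :> R by rewrite pnatr_eq0 -lt0n.
have J2 : 1 + J%:R != 0 :> R by rewrite -mulrS pnatr_eq0.
rewrite addrAC bl_leBrDr; set z := (_ + _ in leLHS).
have zy : z <= y by rewrite -[leRHS](subrK x) bl_leD// leIl.
have zu : z <= u *+ J.+1 by rewrite mulrS bl_leD// leIr.
pose c : R := J%:R / (1 + J%:R).
have c0 : 0 <= c by rewrite divr_ge0// addr_ge0.
have c1 : 0 <= 1 - c by rewrite subr_ge0 ler_pdivrMr ?mul1r ?lerDr// ltr_pwDl.
have hz : c *: z <= q.
  rewrite lexI; apply/andP; split.
    apply: le_trans (bl_leZ c0 zy) _.
    rewrite -bl_subr_ge0 -{1}[y]scale1r -scalerBl; exact: bl_scaler_ge0.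
  apply: le_trans (bl_leZ c0 zu) _.
  by rewrite -(scaler_nat J.+1 u) scalerA mulrS /c divfK// scaler_nat.
have := @bl_leZ c^-1 _ _ _ hz.
rewrite invr_ge0 scalerA mulVf ?scale1r => [/(_ c0) h|]; last first.
  by rewrite mulf_neq0 ?invr_eq0.
apply: le_trans h _; rewrite -{2}[q]scale1r -scalerDl /c invf_div.
by rewrite mulrDl mul1r divff// addrC.
Qed.

End VectorLattice.

(** * Norm convergence of nets in a Banach space *)

Section Nets.
Context {R : realType} {V : completeNormedModType R}.

Definition net_cvg (A : Type) (le : A -> A -> Prop) (x : A -> V) (l : V) :=
  forall e : R, 0 < e -> exists a0, forall a, le a0 a -> `|x a - l| < e.

(** Comparing with the single term [x a0] instead of all pairs in the tail costs only a factor 2 in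
    [e]. *)
Definition net_cauchy (A : Type) (le : A -> A -> Prop) (x : A -> V) :=
  forall e : R, 0 < e -> exists a0, forall a, le a0 a -> `|x a - x a0| < e.

Lemma tails_proper (A : Type) (le : A -> A -> Prop) :
  directed le -> ProperFilter (tails le).
Proof.
case=> [[a] lexx letr dir]; apply: filter_from_proper.
  apply: filter_from_filter; first by exists a.
  move=> i j _ _; have [k [ik jk]] := dir i j.
  by exists k => // b kb; split; [exact: letr ik kb|exact: letr jk kb].
by move=> i _; exists i; exact: lexx.
Qed.

Lemma net_cauchy_cvg (A : Type) (le : A -> A -> Prop) (x : A -> V) :
  directed le -> net_cauchy le x -> exists l, net_cvg le x l.
Proof.
move=> dir cx; have pf := tails_proper dir.
have /cauchy_cvg/cvg_ex[l xl] : cauchy (x @ tails le).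
  apply: cauchy_exP => e e0; have [a0 h] := cx e e0.
  exists (x a0); exists a0 => // a /h.
  by rewrite /= -ball_normE /ball_ /= distrC.
exists l => e e0; move/cvgrPdist_lt : xl => /(_ e e0)[a0 _ h].
by exists a0 => a /h; rewrite distrC.
Qed.

Lemma norm_tails_cvg0P (A : Type) (le : A -> A -> Prop) (x : A -> V) :
  directed le ->
  (`|x a| @[a --> tails le] --> (0 : R)) <-> net_cvg le x 0.
Proof.
move=> dir; have pf := tails_proper dir; split=> [/cvgrPdist_lt h e e0|h].
  have [a0 _ h0] := h e e0; exists a0 => a /h0.
  by rewrite sub0r normrN normr_id subr0.
apply/cvgrPdist_lt => e e0; have [a0 h0] := h e e0.
by exists a0 => // a /h0; rewrite sub0r normrN normr_id subr0.
Qed.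

End Nets.

(** * Limits of nets and the lattice order; epsilon forms of the un-notions *)

Section NetsLattice.
Context {R : realType} {X : banachLatticeType R}.
Context (A : Type) (le : A -> A -> Prop) (dir : directed le).
Implicit Types (x y : A -> X) (l u : X).

Lemma net_cst_cvg l : net_cvg le (fun=> l) l.
Proof. by case: dir => [[a] _ _ _] e e0; exists a => b _; rewrite subrr normr0. Qed.

Lemma net_cvg_norm_le x l (M : R) :
  net_cvg le x l -> (forall a, `|x a| <= M) -> `|l| <= M.
Proof.
case: dir => _ lexx _ _ xl xM; apply/ler_addgt0Pr => e e0.
have [a /(_ a (lexx a)) h] := xl e e0.
have -> : l = x a - (x a - l) by rewrite opprB addrC subrK.
by apply: le_trans (ler_normB _ _) _; rewrite lerD// ltW.
Qed.

Lemma net_cvg_le x y l l' : net_cvg le x l -> net_cvg le y l' ->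
  (forall a, x a <= y a) -> l <= l'.
Proof.
case: dir => _ lexx letr dir2 xl yl xy.
rewrite -[l']add0r -bl_leBlDr; apply: le0_norm_pospart => e e0.
have e2 : 0 < e / 2 by rewrite divr_gt0.
have [a ha] := xl _ e2; have [b hb] := yl _ e2; have [c [ac bc]] := dir2 a b.
have h : l - l' <= (y c - l') - (x c - l).
  rewrite opprB [l - x c]addrC addrACA [- l' + l]addrC -[leLHS]add0r bl_leD2rE.
  by rewrite bl_subr_ge0.
apply: le_trans (norm_pospart_le h) _; apply: le_trans (ler_normB _ _) _.
by rewrite [e]splitr lerD// ltW ?ha ?hb.
Qed.

Lemma un_cauchyP x : un_cauchy le x <-> forall (e : R) u, 0 < e -> 0 <= u ->
  exists a0, forall a b, le a0 a -> le a0 b ->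
    `|(modulus (x a - x b) `&` u)%O| < e.
Proof.
split=> [xc e u e0 u0|xc U [e [u [e0 u0 _ sU]]]]; last first.
  have [a0 h] := xc e u e0 u0.
  by exists a0 => a b a0a a0b; apply/sU/h.
(* Basic un-neighborhoods require [u != 0]; for [u = 0] the truncated modulus is 0. *)
have [->|un0] := eqVneq u 0.
  case: dir => [[a0] _ _ _]; exists a0 => a b _ _.
  by rewrite meet_r ?modulus_ge0// normr0.
by apply: (xc (un_ball e u)); exists e, u; split => // y.
Qed.

Lemma un_cvgP x l : un_cvg le x l <-> forall u, 0 <= u ->
  net_cvg le (fun a => (modulus (x a - l) `&` u)%O) 0.
Proof. by split=> h u /h /norm_tails_cvg0P; apply. Qed.

End NetsLattice.

(** * Monotone sequences and nets *)

Section KB.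
Context {R : realType} {X : banachLatticeType R}.

(** The sequence need not be known to have a supremum, so order continuity is applied to the
    differences [p - x n], where [p] runs down through all upper bounds and [n] runs up. These
    differences decrease to 0. *)
Lemma incr_bounded_cauchy (x : nat -> X) (b : X) : order_continuous_norm X ->
  (forall m n, (m <= n)%N -> x m <= x n) -> (forall n, x n <= b) ->
  forall e : R, 0 < e -> exists N, forall n, (N <= n)%N -> `|x n - x N| < e.
Proof.
move=> hX xm xb e e0.
pose A := {p : X * nat | forall n, x n <= p.1}.
pose leA (p q : A) := (sval q).1 <= (sval p).1 /\ ((sval p).2 <= (sval q).2)%N.
have dirA : directed leA.
  split.
  - by constructor; exists (b, 0%N).
  - by move=> p; split.
  - move=> p q r [h1 h2] [h3 h4]; split; first exact: le_trans h3 h1.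
    exact: leq_trans h2 h4.
  - move=> [[p i] hp] [[q j] hq].
    have hpq n : x n <= (p `&` q)%O by rewrite lexI hp hq.
    exists (exist _ ((p `&` q)%O, maxn i j) hpq).
    by rewrite /leA /= leIl leIr leq_maxl leq_maxr.
pose y (p : A) := (sval p).1 - x (sval p).2.
have y0 p : 0 <= y p by rewrite bl_subr_ge0 (svalP p).
have ydec p q : leA p q -> y q <= y p.
  by case=> h1 h2; apply: bl_leD => //; rewrite bl_leN2 xm.
(* Subtracting a lower bound [z] from an upper bound of [x] leaves an upper
   bound, so every multiple of [z] is dominated by [b - x 0]. *)
have yinf z : (forall p, z <= y p) -> z <= 0.
  move=> hz; apply: (@bl_archimedean _ _ _ (b - x 0%N)) => k.
  suff h n : x n <= b - z *+ k by rewrite bl_leBrDr addrC -bl_leBrDr.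
  elim: k n => [n|k IH n]; first by rewrite mulr0n subr0.
  have := hz (exist _ (b - z *+ k, n) IH); rewrite /y /= => zn.
  by rewrite mulrSr opprD addrA bl_leBrDr [x n + z]addrC -(bl_leBrDr z).
have := hX A leA y dirA ydec y0 yinf.
move=> /(norm_tails_cvg0P _ dirA)/(_ e e0)[[[p N] hp] h].
(* Since [p] is an upper bound, [x n - x N] lies between 0 and [p - x N]. *)
exists N => n Nn.
have := h (exist _ (p, N) hp) (conj (lexx _) (leqnn _)).
rewrite subr0 /y /=; apply: le_lt_trans.
by apply: bl_le_norm_ge0; rewrite ?bl_subr_ge0 ?xm// bl_leD2rE.
Qed.

Lemma directed_leq : directed (fun m n : nat => (m <= n)%N).
Proof.
split=> [|n|m n p|m n]; [by constructor; exact: 0%N|exact: leqnn|exact: leq_trans|].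
by exists (maxn m n); rewrite leq_maxl leq_maxr.
Qed.

Lemma incr_un_cauchy (x : nat -> X) (M : R) : order_continuous_norm X ->
  (forall n, 0 <= x n) -> (forall m n, (m <= n)%N -> x m <= x n) ->
  (forall n, `|x n| <= M) -> un_cauchy (fun m n => (m <= n)%N) x.
Proof.
move=> hX x0 xm xM; apply/(un_cauchyP directed_leq) => e u e0 u0.
have e2 : 0 < e / 2 by rewrite divr_gt0.
(* Chosen so that [M / J <= e / 2], which controls the last term of [meet_incr_le]. *)
pose J := (Num.truncn (M / (e / 2))).+1.
have J0 : 0 < J%:R :> R by rewrite ltr0n.
pose q n := (x n `&` (u *+ J))%O.
have uJ0 : 0 <= u *+ J by rewrite -scaler_nat; apply: bl_scaler_ge0.
have q0 n : 0 <= q n by rewrite lexI x0.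
have qm m n : (m <= n)%N -> q m <= q n by move=> mn; rewrite leI2 ?xm.
have [N hN] := incr_bounded_cauchy hX qm (fun n => leIr _ _) e2.
have qM n : J%:R^-1 * `|q n| <= e / 2.
  rewrite mulrC ler_pdivrMr// mulrC -ler_pdivrMr//.
  apply: (@le_trans _ _ (M / (e / 2))); last by rewrite ltW// truncnS_gt.
  rewrite ler_pM2r ?invr_gt0//; apply: le_trans (xM n).
  by apply: bl_le_norm_ge0 => //; exact: leIl.
have key m n : (N <= m)%N -> (m <= n)%N ->
    `|(modulus (x n - x m) `&` u)%O| < e.
  move=> Nm mn; rewrite ge0_modulus ?bl_subr_ge0 ?xm//.
  have le1 := meet_incr_le (x m) (ltn0Sn _ : 0 < J)%N (x0 n) u0.
  apply: le_lt_trans (bl_le_norm_ge0 _ le1) _.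
    by rewrite lexI bl_subr_ge0 xm.
  apply: le_lt_trans (ler_normD _ _) _; rewrite [e]splitr ltr_leD//.
    apply: le_lt_trans (hN n (leq_trans Nm mn)).
    by apply: bl_le_norm_ge0; rewrite ?bl_subr_ge0 ?qm// bl_leD2lE bl_leN2 qm.
  by rewrite normrZ (@gtr0_norm _ (J%:R^-1 : R)) ?invr_gt0//; exact: qM.
exists N => m n Nm Nn; have [mn|/ltnW nm] := leqP m n; last exact: key.
by rewrite modulus_distC key.
Qed.

(** If the net were not Cauchy, every index would have a later one at distance at least [e].
    Iterating this choice gives an increasing bounded sequence whose consecutive terms stay [e]
    apart, although the KB property makes it converge. *)
Lemma KB_net_cauchy (A : Type) (le : A -> A -> Prop) (f : A -> X) (M : R) :
  KB_space X -> directed le -> (forall a, 0 <= f a) ->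
  (forall a b, le a b -> f a <= f b) -> (forall a, `|f a| <= M) ->
  net_cauchy le f.
Proof.
move=> KB [[a1] lexx letr _] f0 fm fM e e0; apply: contrapT => nh.
have next a : exists b, le a b /\ e <= `|f b - f a|.
  apply: contrapT => na; apply: nh; exists a => b ab; rewrite ltNge.
  by apply/negP => eb; apply: na; exists b.
have [g hg] := choice next.
pose s n := iter n g a1.
have sm m n : (m <= n)%N -> le (s m) (s n).
  move=> /subnK <-; elim: (n - m)%N => [|k IH]; first exact: lexx.
  by apply: letr IH _; rewrite addSn; case: (hg (s (k + m)%N)).
have /cvg_ex[l] : cvg ((f \o s) @ \oo).
  apply: KB => [n|m n mn|]; [exact: f0|exact/fm/sm|].
  by exists M => n; exact: fM.
move/cvgrPdist_lt => /(_ (e / 2))[|N _ hN]; first by rewrite divr_gt0.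
have [_] := hg (s N); rewrite leNgt => /negP; apply.
have -> : f (g (s N)) - f (s N) = (l - f (s N)) - (l - f (s N.+1)).
  by rewrite opprB [RHS]addrC addrA subrK.
apply: le_lt_trans (ler_normB _ _) _.
by rewrite [e]splitr ltrD// hN /=.
Qed.

End KB.

(** * Un-completeness of the unit ball *)

Section UnitBall.
Context {R : realType} {X : banachLatticeType R}.

Lemma un_complete_KB : order_continuous_norm X ->
  un_complete (closed_unit_ball X) -> KB_space X.
Proof.
move=> hX uc x x0 xm [M0 xM0].
(* A positive bound is needed to rescale the sequence into the unit ball. *)
have [M M_gt0 xM] : exists2 M : R, 0 < M & forall n, `|x n| <= M.
  exists (Num.max 1 M0) => [|n]; first by rewrite lt_max ltr01.
  by rewrite le_max xM0 orbT.
pose y n := M^-1 *: x n.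
have M0' : 0 <= M^-1 by rewrite invr_ge0 ltW.
have y0 n : 0 <= y n by exact: bl_scaler_ge0.
have ym m n : (m <= n)%N -> y m <= y n by move=> mn; apply: bl_leZ => //; exact: xm.
have y1 n : `|y n| <= 1.
  by rewrite normrZ ger0_norm// mulrC ler_pdivrMr// mul1r.
have [l _ /(un_cvgP directed_leq) yl] :=
  uc _ _ y directed_leq y1 (incr_un_cauchy hX y0 ym y1).
(* Test against [u], the positive part of [y n - l]: for [m >= n] it lies below [|y m - l|] by
   monotonicity, hence below its truncation at [u]. *)
have yle n : y n <= l.
  rewrite -[l]add0r -bl_leBlDr; apply: le0_norm_pospart => e e0.
  have [N hN] := yl _ (pospart_ge0 (y n - l)) e e0.
  have := hN (maxn N n) (leq_maxl _ _); rewrite subr0 => /ltW; apply: le_trans.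
  apply: bl_le_norm_ge0; first exact: pospart_ge0.
  rewrite lexI lexx andbT; apply: pospart_le_modulus.
  by rewrite bl_leD2rE ym// leq_maxr.
have l0 : 0 <= l by exact: le_trans (y0 0%N) (yle 0%N).
(* As [0 <= y n <= l], the difference [l - y n] lies below [l], so truncating at [l] leaves it
   unchanged. *)
have cy : y n @[n --> \oo] --> l.
  apply/cvgrPdist_lt => e e0; have [N hN] := yl _ l0 e e0.
  exists N => // n /hN; rewrite subr0; apply: le_lt_trans.
  apply: bl_le_norm_ge0; first by rewrite bl_subr_ge0.
  by rewrite modulus_distC lexI modulus_ge -{2}[l]subr0 bl_leD2lE bl_leN2 y0.
apply/cvg_ex; exists (M *: l).
have -> : x = (fun n => M *: y n).
  by apply/funext => n; rewrite scalerA divff ?scale1r ?gt_eqF.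
exact: cvgZ (cvg_cst _) cy.
Qed.

Lemma KB_pos_un_complete (A : Type) (le : A -> A -> Prop) (x : A -> X) (M : R) :
  KB_space X -> directed le -> (forall a, 0 <= x a) -> (forall a, `|x a| <= M) ->
  un_cauchy le x -> exists l, un_cvg le x l.
Proof.
move=> KB dir x0 xM /(un_cauchyP dir) xc.
have [_ lexx' _ dir2] := dir.
(* Positivity of [u] is placed under the existential so that [choice] yields [T] on all of [X], with
   default value 0 off the cone. *)
have trunc_cvg (u : X) : exists t, 0 <= u -> net_cvg le (fun a => (x a `&` u)%O) t.
  have [u0|] := boolP (0 <= u); last by move=> _; exists 0.
  have [t ht] : exists t, net_cvg le (fun a => (x a `&` u)%O) t; last by exists t.
  apply: (net_cauchy_cvg dir) => e e0; have [a0 h] := xc e u e0 u0.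
  exists a0 => a a0a; apply: le_lt_trans (h a a0 a0a (lexx' _)).
  rewrite -(norm_modulus (_ - _)); apply: bl_le_norm_ge0; first exact: modulus_ge0.
  by rewrite lexI modulus_meetB modulus_meetB_le.
have {trunc_cvg}[T hT] := choice trunc_cvg.
pose P := {u : X | 0 <= u}.
pose leP (u v : P) := sval u <= sval v.
have dirP : directed leP.
  split=> [|u|u v w|u v]; [|exact: lexx|exact: le_trans|].
    by constructor; exists 0; exact: lexx.
  have uv0 : 0 <= (sval u `|` sval v)%O by apply: le_trans (svalP u) (leUl _ _).
  by exists (exist (fun w : X => is_true (0 <= w)) _ uv0); rewrite /leP /= leUl leUr.
have T0 (p : P) : 0 <= T (sval p).
  apply: (net_cvg_le dir (net_cst_cvg dir 0) (hT _ (svalP p))) => a.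
  by rewrite lexI x0 (svalP p).
have Tm (p q : P) : leP p q -> T (sval p) <= T (sval q).
  move=> pq; apply: (net_cvg_le dir (hT _ (svalP p)) (hT _ (svalP q))) => a.
  exact: leI2.
have TM (p : P) : `|T (sval p)| <= M.
  apply: (net_cvg_norm_le dir (hT _ (svalP p))) => a; apply: le_trans (xM a).
  by apply: bl_le_norm_ge0 (leIl _ _); rewrite lexI x0 (svalP p).
have [l Tl] := net_cauchy_cvg dirP (KB_net_cauchy KB dirP T0 Tm TM).
have l0 : 0 <= l := net_cvg_le dirP (net_cst_cvg dirP 0) Tl T0.
(* Take [v] above both [w] and an index [p] past which [T] is close to [l]. Truncating at [w]
   factors through truncating at [v], so nonexpansiveness reduces the claim to [T v] being near
   [l]. *)
have key w : 0 <= w -> net_cvg le (fun a => (x a `&` w)%O) (l `&` w)%O.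
  move=> w0 e e0; have e2 : 0 < e / 2 by rewrite divr_gt0.
  have [p hp] := Tl _ e2.
  have v0 : 0 <= (sval p `|` w)%O by apply: le_trans w0 (leUr _ _).
  set v := (_ `|` _)%O in v0; have [a0 ha0] := hT _ v0 _ e2.
  exists a0 => a /ha0 h1; have h2 := hp (exist (fun w : X => is_true (0 <= w)) v v0) (leUl _ _).
  have -> : (x a `&` w)%O = ((x a `&` v) `&` w)%O by rewrite -meetA (@meet_r _ _ v w (leUr _ _)).
  have := modulus_meetB (x a `&` v)%O l w => /le_norm_modulus.
  move=> /le_lt_trans; apply; rewrite -(subrK (T v) (_ `&` _)%O) -addrA.
  by apply: le_lt_trans (ler_normD _ _) _; rewrite [e]splitr ltrD.
exists l; apply/(un_cvgP dir) => u u0 e e0.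
(* [modulus_meet_le] has three terms; the truncations at [u + l] and at [l] both tend to [l], so
   each term is eventually below [e / 3]. *)
have e3 : 0 < e / 3 by rewrite divr_gt0.
have [a ha] := key _ (bl_addr_ge0 u0 l0) _ e3.
have [b hb] := key _ l0 _ e3.
have [c [ac bc]] := dir2 a b; exists c => d cd; rewrite subr0.
have [_ _ letr _] := dir.
have {ha} := ha d (letr _ _ _ ac cd); have {hb} := hb d (letr _ _ _ bc cd).
have -> : (l `&` (u + l))%O = l.
  by apply: meet_l; rewrite -[leLHS]add0r bl_leD2rE.
rewrite meetxx distrC => h1 h2.
have := modulus_meet_le (x d) l0 u0.
move=> /(bl_le_norm_ge0 _) /le_lt_trans; apply.
  by rewrite lexI modulus_ge0.
apply: le_lt_trans (ler_normD _ _) _.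
have := ler_normD ((x d `&` (u + l))%O - l) (l - (x d `&` l)%O).
lra.
Qed.

Lemma KB_un_complete : KB_space X -> un_complete (closed_unit_ball X).
Proof.
move=> KB A le x dir x1 xc.
(* Taking positive parts preserves the norm bound and the un-Cauchy property. It is applied to [x]
   and [- x], and the two limits are subtracted. *)
have part (s : A -> X) : (forall a, `|s a| <= 1) -> un_cauchy le s ->
    exists l, un_cvg le (pospart \o s) l.
  move=> s1 sc; apply: (@KB_pos_un_complete _ _ _ 1) => // [a|a|].
  - exact: pospart_ge0.
  - exact: le_trans (norm_pospart_le (lexx _)) (s1 a).
  apply/(un_cauchyP dir) => e u e0 u0.
  have [a0 h] := (un_cauchyP dir s).1 sc e u e0 u0.
  exists a0 => a b a0a a0b; apply: le_lt_trans (h a b a0a a0b).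
  apply: bl_le_norm_ge0; first by rewrite lexI modulus_ge0.
  by rewrite leI2// modulus_pospartB.
have [p /(un_cvgP dir) hp] := part x x1 xc.
have nx1 a : `|- x a| <= 1 by rewrite normrN; exact: x1.
have nxc : un_cauchy le (fun a => - x a).
  apply/(un_cauchyP dir) => e u e0 u0.
  have [a0 h] := (un_cauchyP dir x).1 xc e u e0 u0.
  by exists a0 => a b a0a a0b; rewrite -opprD modulusN; exact: h.
have [n /(un_cvgP dir) hn] := part _ nx1 nxc.
have xl : un_cvg le x (p - n).
  apply/(un_cvgP dir) => u u0 e e0.
  have e2 : 0 < e / 2 by rewrite divr_gt0.
  have [a ha] := hp u u0 _ e2; have [b hb] := hn u u0 _ e2.
  have [_ _ letr dir2] := dir; have [c [ac bc]] := dir2 a b.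
  exists c => d cd.
  have := ha d (letr _ _ _ ac cd); have := hb d (letr _ _ _ bc cd).
  rewrite /= !subr0 => h1 h2; rewrite [e]splitr.
  apply: le_lt_trans (ltrD h2 h1); apply: le_trans (ler_normD _ _).
  apply: bl_le_norm_ge0; first by rewrite lexI modulus_ge0.
  apply: le_trans (meetD_le (modulus_ge0 _) (modulus_ge0 _) u0).
  rewrite leI2//.
  have -> : x d - (p - n) = (pospart (x d) - p) - (pospart (- x d) - n).
    by rewrite -{1}[x d]pospartB !opprB [n - p]addrC addrACA [n - pospart _]addrC.
  by apply: le_trans (modulusD _ _) _; rewrite modulusN.
exists (p - n) => //; rewrite /closed_unit_ball /=; set l := p - n.
apply/ler_addgt0Pr => e e0.
(* The ball is un-closed: testing against [modulus l] bounds the norm of [l] by [e] plus that of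
   [x a]. *)
have [a ha] := (un_cvgP dir x l).1 xl _ (modulus_ge0 l) e e0.
have [_ lexx' _ _] := dir; have := ha a (lexx' a); rewrite subr0 => h.
have le1 : modulus l <= (modulus (x a - l) `&` modulus l)%O + modulus (x a).
  rewrite meetDr lexI; apply/andP; split.
    rewrite modulus_distC; apply: le_trans (modulusD _ _).
    by rewrite subrK.
  by rewrite -[leLHS]addr0 bl_leD2lE modulus_ge0.
rewrite -(norm_modulus l); apply: le_trans (bl_le_norm_ge0 (modulus_ge0 _) le1) _.
apply: le_trans (ler_normD _ _) _; rewrite addrC norm_modulus.
by rewrite lerD//; [exact: x1|exact: ltW].
Qed.

End UnitBall.

Theorem theorem6p4 (R : realType) (X : banachLatticeType R)
  (hX : order_continuous_norm X) :
  un_complete (closed_unit_ball X) <-> KB_space X.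
Proof.
split; [exact: un_complete_KB | exact: KB_un_complete].
Qed.
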